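(* The sporadic simple Mathieu group $M_{12}$ (of order $95040$) has an Ordered Generating System.
   Context: Definition. A sequence of elements $a_1,\ldots,a_n$ of a group $G$ is an Ordered Generating System of $G$ if there exist non-negative integers $m_1,\ldots,m_n$ such that every element $g\in G$ has a unique representation of the form $g=a_1^{i_1}a_2^{i_2}\cdots a_n^{i_n}$ with integers $0\le i_k\le m_k$ for every $1\le k\le n$ (i.e. the exponent tuple $(i_1,\ldots,i_n)$ in this range exists and is unique). A group is said to have an Ordered Generating System if such a finite sequence exists. *)

(* Defs.v *)
From mathcomp Require Import all_boot all_order all_algebra all_fingroup.

Set Implicit Arguments.
Unset Strict Implicit.
Unset Printing Implicit Defensive.

Local Open Scope group_scope.

(* A group with an ordered generating system is finite, so finite groups lose
   no generality.  The product is ordered: tnth a ord0 comes first. *)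
Definition is_OGS (gT : finGroupType) (G : {group gT})
    (n : nat) (a : n.-tuple gT) : Prop :=
  (forall k : 'I_n, tnth a k \in G) /\
  exists m : n.-tuple nat,
    forall g : gT, g \in G ->
      exists! i : n.-tuple nat,
        (forall k : 'I_n, tnth i k <= tnth m k) /\
        g = \prod_(k < n) tnth a k ^+ tnth i k.

Definition has_OGS (gT : finGroupType) (G : {group gT}) : Prop :=
  exists (n : nat) (a : n.-tuple gT), is_OGS G a.

Definition cycle_perm (T : finType) (c : seq T) (Uc : uniq c) : {perm T} :=
  perm (can_inj (prev_next Uc)).

(* The twelve points are those of the projective line over F_11: u < 11 stands
   for the residue u and 11 for infinity.  The three permutations are
   u |-> u + 1, u |-> - 1 / u (these two generate PSL(2, 11)) and
   u |-> 4 u ^ 2 - 3 u ^ 7; see Conway and Sloane, Sphere Packings, Lattices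
   and Groups. *)
Definition M12_alpha : 'S_12 :=
  @cycle_perm 'I_12 [:: 0; 1; 2; 3; 4; 5; 6; 7; 8; 9; 10]%R isT.

Definition M12_gamma : 'S_12 :=
  @cycle_perm 'I_12 [:: 0; 11]%R isT * @cycle_perm 'I_12 [:: 1; 10]%R isT *
  @cycle_perm 'I_12 [:: 2; 5]%R isT * @cycle_perm 'I_12 [:: 3; 7]%R isT *
  @cycle_perm 'I_12 [:: 4; 8]%R isT * @cycle_perm 'I_12 [:: 6; 9]%R isT.

Definition M12_delta : 'S_12 :=
  @cycle_perm 'I_12 [:: 2; 6; 10; 7]%R isT *
  @cycle_perm 'I_12 [:: 3; 9; 4; 5]%R isT.

Definition M12 : {group 'S_12} := <<[set M12_alpha; M12_gamma; M12_delta]>>%G.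

(* Main.v *)
Require Import Defs.
From mathcomp Require Import all_boot all_order all_algebra all_fingroup.

(** M12 is sharply 5-transitive, so the successive point stabilisers of
    [0, 11, 4, 6, 1] have indices 12, 11, 10, 9, 8 and end in the trivial group.
    At each step the right cosets of the next stabiliser are represented by
    ordered products of powers of at most two elements, because these products
    move the base point to distinct points; concatenating the five families,
    deepest stabiliser first, gives the system.  No order is needed in advance:
    as in Schreier's lemma, the ordered products form a group as soon as every
    representative times every generator is again an ordered product, and this
    is a finite computation on tables of values. *)

Set Implicit Arguments.
Unset Strict Implicit.
Unset Printing Implicit Defensive.

Local Open Scope group_scope.

(** * Ordered products with bounded exponents *)

Lemma uniq_map_inj_in (T1 T2 : eqType) (f : T1 -> T2) (s : seq T1) :
  uniq (map f s) -> {in s &, injective f}.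
Proof.
elim: s => //= x s IHs /andP[fx fs] u v; rewrite !inE.
case/predU1P=> [->|us]; case/predU1P=> [->|vs] // fE; last exact: IHs fE.
  by rewrite fE map_f in fx.
by rewrite -fE map_f in fx.
Qed.

Fixpoint box (m : seq nat) : seq (seq nat) :=
  if m is k :: m' then [seq j :: i | j <- iota 0 k.+1, i <- box m']
  else [:: [::]].

Lemma mem_box (m i : seq nat) : (i \in box m) = all2 leq i m.
Proof.
elim: m i => [|k m IHm] [|j i] //; first by apply/negP => /allpairsP[[u v] []].
rewrite [RHS]/= -IHm; apply/allpairsP/andP => [[[u v] /= [+ im [-> ->]]]|[jk im]].
  by rewrite (mem_iota 0 k.+1).
by exists (j, i); split; rewrite // (mem_iota 0 k.+1).
Qed.

Lemma box_cat (m1 m2 : seq nat) :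
  box (m1 ++ m2) = [seq i ++ j | i <- box m1, j <- box m2].
Proof.
elim: m1 => [|k m1 IHm1]; first by rewrite /= cats0 map_id.
rewrite cat_cons /box -/box IHm1; elim: (iota 0 k.+1) => //= u s ->.
by rewrite map_allpairs allpairs_cat allpairs_mapl.
Qed.

Section OrderedProducts.
Variable gT : finGroupType.
Implicit Types (a b c : seq gT) (i m : seq nat).

Definition oprod a i : gT := \prod_(p <- zip a i) p.1 ^+ p.2.

Definition oprods a m : seq gT := [seq oprod a i | i <- box m].

Definition ogs a m : Prop :=
  uniq (oprods a m) /\ {subset <<[set x in a]>> <= oprods a m}.

(** Equal sizes keep [zip] aligned at the junction of the two lists. *)
Lemma oprod_cat b c i j :
  size b = size i -> oprod (b ++ c) (i ++ j) = oprod b i * oprod c j.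
Proof. by move=> sz_b; rewrite /oprod zip_cat // big_cat. Qed.

Lemma oprods_cat b c mb mc : size b = size mb ->
  oprods (b ++ c) (mb ++ mc) = [seq g * h | g <- oprods b mb, h <- oprods c mc].
Proof.
move=> sz_b; rewrite /oprods box_cat map_allpairs allpairs_mapl allpairs_mapr.
apply/eq_in_allpairs => i j i_mb _; apply: oprod_cat.
by move: i_mb; rewrite mem_box all2E sz_b => /andP[/eqP].
Qed.

Lemma oprod_group (G : {group gT}) a i :
  {subset a <= G} -> oprod a i \in G.
Proof.
elim: a i => [|x a IHa] [|j i] aG; rewrite /oprod /= ?big_nil ?group1 //.
rewrite big_cons; apply: groupM; first by rewrite groupX // aG ?mem_head.
by apply: (IHa i) => y ya; rewrite aG // inE ya orbT.
Qed.

Lemma one_in_oprods a m : 1 \in oprods a m.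
Proof.
apply/mapP; exists (nseq (size m) 0).
  by rewrite mem_box; elim: m => //= k m ->.
elim: a (size m) => [|x a IHa] [|n]; rewrite /oprod /= ?big_nil //.
by rewrite big_cons expg0 mul1g; apply: (IHa n).
Qed.

(** In a finite group inverses are positive powers, so each element of [<<A>>] is a product of
    elements of [A], built up by right multiplications. *)
Lemma gen_sub_closed (A : {set gT}) (P : {pred gT}) :
    1 \in P -> {in P & A, forall g s, g * s \in P} -> {subset <<A>> <= P}.
Proof.
move=> P1 PM _ /gen_prodgP[n [c cA ->]].
elim: n c cA => [|n IHn] c cA; first by rewrite big_ord0.
by rewrite big_ord_recr PM ?IHn.
Qed.

Lemma oprod_tnth n (a : n.-tuple gT) (i : n.-tuple nat) :
  oprod a i = \prod_(k < n) tnth a k ^+ tnth i k.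
Proof.
rewrite /oprod (big_tuple _ _ (zip_tuple a i)); apply: eq_bigr => k _.
by rewrite !(tnth_nth (1, 0)) !(tnth_nth 1) !(tnth_nth 0) nth_zip ?size_tuple.
Qed.

Lemma tuple_box n (i m : n.-tuple nat) :
  reflect (forall k, tnth i k <= tnth m k) (val i \in box m).
Proof.
rewrite mem_box all2E !size_tuple eqxx /=.
apply: (iffP (all_tnthP (t := zip_tuple i m))) => im k; move: (im k);
  by rewrite !(tnth_nth (0, 0)) !(tnth_nth 0) nth_zip ?size_tuple.
Qed.

Lemma ogs_is_OGS n (G : {group gT}) (a : n.-tuple gT) (m : n.-tuple nat) :
  <<[set x in a]>> = G -> ogs a m -> is_OGS G a.
Proof.
move=> defG [Ua sGa]; split=> [k|].
  by rewrite -defG mem_gen // inE mem_tnth.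
exists m => g; rewrite -defG => /sGa/mapP[i im ->].
have sz_i: size i == n.
  by move: im; rewrite mem_box all2E size_tuple => /andP[].
exists (Tuple sz_i); split=> [|j [/tuple_box jm]].
  by split; [apply/tuple_box | rewrite -oprod_tnth].
rewrite -oprod_tnth => eq_ij; apply: val_inj.
exact: (uniq_map_inj_in Ua im jm eq_ij).
Qed.

End OrderedProducts.

(** * Extending a system from a point stabiliser *)

Lemma ogs_cat_stab (T : finType) (x : T) (b c : seq {perm T}) (mb mc : seq nat) :
    size b = size mb -> ogs b mb -> {in b, forall s : {perm T}, s x = x} ->
    uniq [seq (h : {perm T}) x | h <- oprods c mc] ->
    {in oprods c mc & b ++ c,
      forall h s, h * s \in oprods (b ++ c) (mb ++ mc)} ->
  ogs (b ++ c) (mb ++ mc).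
Proof.
move=> sz_b [Ub sb] fix_b Uc cM; split.
  rewrite oprods_cat //; apply: allpairs_uniq => //; first exact: map_uniq Uc.
  move=> _ q /allpairsP[[_ h] /= [/mapP[i _ ->] h_c ->]].
  case/allpairsP=> -[_ h'] /= [/mapP[i' _ ->] h'_c ->{q}] /=.
  have fix_x j: oprod b j x = x.
    have /astab1P: oprod b j \in 'C[x | 'P].
      by apply: oprod_group => s /fix_b sx; apply/astab1P.
    by [].
  (* The left factor acts first and fixes [x], so the image of [x] depends only on the right factor
     and determines it. *)
  move=> eq_gh; have eq_h: h = h'.
    apply: (uniq_map_inj_in Uc h_c h'_c).
    by have := congr1 (fun s : {perm T} => s x) eq_gh; rewrite !permM !fix_x.
  by move: eq_gh; rewrite eq_h => /mulIg ->.
apply: gen_sub_closed => [|p s]; first exact: one_in_oprods.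
rewrite oprods_cat // inE => /allpairsP[[u h] /= [u_b h_c ->]] s_bc.
(* Write [h * s = u' * h']; then [u * h * s = (u * u') * h'], and [u * u'] stays in the group
   generated by [b], hence among its ordered products. *)
rewrite -mulgA; have:= cM h s h_c s_bc.
rewrite oprods_cat // => /allpairsP[[u' h'] /= [u'_b h'_c ->]].
rewrite mulgA; apply: allpairs_f => //; apply: sb.
by move: u_b u'_b => /mapP[i _ ->] /mapP[j _ ->];
  rewrite groupM // oprod_group // => y yb; rewrite mem_gen // inE.
Qed.

(** * Computing with tables of values *)

Section Tables.
Variable n : nat.
Implicit Types (s t : seq nat) (A : seq (seq nat)) (i m : seq nat).

Definition tab (p : 'S_n) : seq nat := [seq val (p k) | k <- enum 'I_n].
Definition tmul s t : seq nat := [seq nth 0 t k | k <- s].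
Definition tinv t : seq nat := [seq index k t | k <- iota 0 n].
Definition tone : seq nat := iota 0 n.
Definition toprod A i : seq nat :=
  foldr (fun q => tmul (iter q.2 (tmul q.1) tone)) tone (zip A i).

Lemma nth_tab (p : 'S_n) (k : 'I_n) : nth 0 (tab p) k = p k.
Proof. by rewrite (nth_map k) ?size_enum_ord // nth_ord_enum. Qed.

Lemma tab_inj : injective tab.
Proof.
by move=> p q eq_pq; apply/permP=> k; apply: val_inj; rewrite /= -!nth_tab eq_pq.
Qed.

Lemma tab1 : tab 1 = tone.
Proof. by rewrite -[RHS]val_enum_ord; apply: eq_map => k; rewrite perm1. Qed.

Lemma tabM (p q : 'S_n) : tab (p * q) = tmul (tab p) (tab q).
Proof. by rewrite /tmul -map_comp; apply: eq_map => k /=; rewrite permM nth_tab. Qed.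

Lemma tabX (p : 'S_n) k : tab (p ^+ k) = iter k (tmul (tab p)) tone.
Proof. by elim: k => [|k IHk]; rewrite ?expg0 ?tab1 // expgS tabM IHk. Qed.

Lemma tab_oprod (a : seq 'S_n) i : tab (oprod a i) = toprod (map tab a) i.
Proof.
rewrite /oprod /toprod; elim: a i => [|p a IHa] [|k i] /=; rewrite ?big_nil ?tab1 //.
by rewrite big_cons tabM tabX IHa.
Qed.

(** Reduces a cycle to [next] on a list of naturals, which evaluates. *)
Lemma tab_cycle (c : seq 'I_n) (Uc : uniq c) :
  tab (cycle_perm Uc) = [seq next (map val c) k | k <- iota 0 n].
Proof.
rewrite -val_enum_ord -map_comp; apply: eq_map => k /=.
by rewrite permE (next_map val_inj Uc).
Qed.

(* A level is a base point, the tables of the elements whose ordered products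
   represent the cosets of the next stabiliser, and their maximal exponents.
   The first level of a chain is the one of the whole group. *)
Notation level := (nat * seq (seq nat) * seq nat)%type.

Fixpoint chain_tabs (L : seq level) : seq (seq nat) :=
  if L is l :: L' then chain_tabs L' ++ l.1.2 else [::].

Fixpoint chain_bounds (L : seq level) : seq nat :=
  if L is l :: L' then chain_bounds L' ++ l.2 else [::].

(** Dividing [t] on the right by the representative that sends [x] to the same point leaves an
    element fixing [x], sifted further down; deeper exponents come first. The result is only a
    guess, possibly with the default [[::]]: [sifts] multiplies it out and compares. *)
Fixpoint sift (L : seq level) t : seq nat :=
  if L is (x, A, m) :: L' then
    let moves i := nth 0 (toprod A i) x == nth 0 t x in
    let i := nth [::] (box m) (find moves (box m)) in
    sift L' (tmul t (tinv (toprod A i))) ++ i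
  else [::].

Definition sifts L t : bool :=
  let i := sift L t in
  all2 leq i (chain_bounds L) && (toprod (chain_tabs L) i == t).

Fixpoint chain_ok (L : seq level) : bool :=
  if L is (x, A, m) :: L' then
    [&& chain_ok L', x < n, size A == size m,
        all (fun t => nth 0 t x == x) (chain_tabs L'),
        uniq [seq nth 0 (toprod A i) x | i <- box m]
      & all (fun i => all (fun s => sifts L (tmul (toprod A i) s)) (chain_tabs L))
          (box m)]
  else true.

Lemma size_chain (L : seq level) :
  chain_ok L -> size (chain_tabs L) = size (chain_bounds L).
Proof.
elim: L => //= -[[x A] m] L IHL /and5P[/IHL sz_L _ /eqP sz_A _ _].
by rewrite !size_cat sz_L sz_A.
Qed.

Lemma chain_ogs (L : seq level) (a : seq 'S_n) :
  chain_ok L -> map tab a = chain_tabs L -> ogs a (chain_bounds L).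
Proof.
elim: L a => [|[[x A] m] L IHL] a okL aL.
  case: a aL => // _; split=> // g.
  by rewrite set_nil gen0 => /set1P ->; apply: one_in_oprods.
have /= := okL; move=> /and5P[ok_L xn /eqP sz_A fix_x /andP[Ux clos]].
(* The first [N] elements of [a] belong to the deeper levels, the others to the level of [x]. *)
set N := size (chain_tabs L).
have aN: a = take N a ++ drop N a by rewrite cat_take_drop.
have bL: map tab (take N a) = chain_tabs L by rewrite map_take aL /= take_size_cat.
have cA: map tab (drop N a) = A by rewrite map_drop aL /= drop_size_cat.
rewrite aN; apply: (@ogs_cat_stab _ (Ordinal xn)).
- by rewrite -size_chain // -bL size_map.
- exact: IHL.
- move=> s s_b; apply: val_inj; rewrite -[LHS]nth_tab /=; apply/eqP.
  by apply: (allP fix_x); rewrite -bL map_f.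
- rewrite -(map_inj_uniq val_inj) -2!map_comp; congr uniq: Ux.
  by apply: eq_map => i /=; rewrite -nth_tab tab_oprod cA.
move=> _ s /mapP[i im ->] s_a; rewrite -aN in s_a *.
have /allP/(_ _ im)/allP/(_ (tab s)) := clos.
rewrite -[chain_tabs L ++ A]/(chain_tabs ((x, A, m) :: L)) -aL map_f //.
(* Any exponents [j] that pass the check will do; injectivity of [tab] carries the equality of
   tables back to permutations. *)
move=> /(_ isT); rewrite /sifts; move: (sift _ _) => j /andP[jm /eqP].
rewrite -aL -tab_oprod -cA -tab_oprod -tabM.
by move=> /tab_inj <-; apply: map_f; rewrite mem_box.
Qed.

End Tables.

(** * The system of the Mathieu group *)

Definition M12_chain : seq (nat * seq (seq nat) * seq nat) :=
  ([:: (0, [:: [:: 1; 2; 3; 4; 5; 6; 7; 8; 9; 10; 0; 11];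
               [:: 10; 5; 7; 8; 2; 9; 3; 4; 6; 1; 11; 0]], [:: 3; 2]);
       (11, [:: [:: 0; 6; 8; 9; 3; 10; 4; 5; 7; 2; 11; 1]], [:: 10]);
       (4, [:: [:: 0; 1; 6; 9; 5; 3; 10; 2; 8; 4; 7; 11];
               [:: 0; 5; 4; 10; 8; 7; 9; 6; 3; 1; 2; 11]], [:: 1; 4]);
       (6, [:: [:: 0; 3; 7; 5; 4; 9; 8; 6; 2; 1; 10; 11];
               [:: 0; 6; 5; 2; 4; 3; 9; 8; 10; 1; 7; 11]], [:: 2; 2]);
       (1, [:: [:: 0; 7; 5; 1; 4; 10; 6; 9; 2; 3; 8; 11];
               [:: 0; 5; 3; 10; 4; 9; 6; 2; 1; 8; 7; 11]], [:: 3; 1])])%N.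

(** Words in the generators for the tables of [M12_chain], one line per level, deepest first. *)
Definition M12_system : seq 'S_12 :=
  let a := M12_alpha in let g := M12_gamma in let d := M12_delta in
  [:: a ^+ 3 * d * a ^+ 2; a * d * a ^+ 3 * d ^+ 3 * a ^+ 2;
      g * d * g; a * d * a * d ^+ 2 * a * g * d * g;
      d; a ^+ 2 * d ^+ 2 * a;
      a * g * a;
      a; a * g].

(** The inclusive bounds give 4*3, 11, 2*5, 3*3 and 4*2 representatives, matching the indices 12,
    11, 10, 9, 8. *)
Lemma M12_chain_ok : chain_ok 12 M12_chain.
Proof. by vm_compute. Qed.

Lemma tab_M12_system : map (@tab 12) M12_system = chain_tabs M12_chain.
Proof. by rewrite /= !(tabM, tabX) !tab_cycle; vm_compute. Qed.

Lemma gen_M12_system : <<[set x in M12_system]>> = M12.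
Proof.
apply/eqP; rewrite eqEsubset !gen_subG; apply/andP; split; apply/subsetP => p.
  have [aM gM dM] : [/\ M12_alpha \in M12, M12_gamma \in M12 & M12_delta \in M12].
    by split; rewrite mem_gen // !inE eqxx ?orbT.
  have /allP: all [in M12] M12_system.
    rewrite /= andbT; do ![apply/andP; split];
      by do ?[exact: aM | exact: gM | exact: dM | apply: groupX | apply: groupM].
  by rewrite inE; apply.
have gen_sys q : q \in M12_system -> q \in <<[set x in M12_system]>>.
  by move=> q_sys; rewrite mem_gen // inE.
have aG := gen_sys M12_alpha; have agG := gen_sys (M12_alpha * M12_gamma).
rewrite !inE => /orP[/orP[]|] /eqP->.
- by rewrite aG // !inE eqxx ?orbT.
(* [M12_gamma] is recovered from the entries [a] and [a * g]. *)
- by rewrite -(groupMl _ (aG _)) ?agG ?aG // !inE eqxx ?orbT.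
- by rewrite gen_sys // !inE eqxx ?orbT.
Qed.

Theorem theorem4 : has_OGS M12.
Proof.
exists 9, (in_tuple M12_system).
apply: (@ogs_is_OGS _ _ _ _ (in_tuple (chain_bounds M12_chain))).
  exact: gen_M12_system.
exact: chain_ogs M12_chain_ok tab_M12_system.
Qed.
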